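(* Let $G$ be a polycyclic-by-finite group, $R$ a commutative strongly graded ring of type $G$, and $M$ a graded $R$-module. If $M_e$ is a Noetherian $R_e$-module, then for every proper graded $R$-submodule $N$ of $M$ there exists $s\in h^*(R)$ such that $N\in GSpec_s({}_RM)$.
   Context: $e$ denotes the identity of $G$; rings are commutative with nonzero unity $1$ and modules are unital. $G$ is polycyclic-by-finite if there is a finite series $\{e\}=G_0\triangleleft G_1\triangleleft\cdots\triangleleft G_n=G$ with each $G_{i-1}$ normal in $G_i$ and each $G_i/G_{i-1}$ finite or cyclic. A ring $R$ is $G$-graded if $R=\bigoplus_{g\in G}R_g$ with additive subgroups $R_g$ satisfying $R_gR_h\subseteq R_{gh}$; it is strongly graded of type $G$ if $1\in R_\sigma R_{\sigma^{-1}}$ for all $\sigma\in G$, equivalently $R_\tau R_\sigma=R_{\tau\sigma}$ for all $\tau,\sigma\in G$. $h(R)=\bigcup_{g\in G}R_g$ and $h^*(R)=h(R)\setminus\{0\}$. An $R$-module $M$ is graded if $M=\bigoplus_{g\in G}M_g$ with additive subgroups $M_g$ satisfying $R_gM_h\subseteq M_{gh}$; $h(M)=\bigcup_{g\in G}M_g$. A submodule $N$ of $M$ is graded if $N=\bigoplus_{g\in G}(N\cap M_g)$. Write $(N:_RM)=\{r\in R: rM\subseteq N\}$. For $s\in h^*(R)$, a graded $R$-submodule $N$ of $M$ is graded $s$-prime if $s\notin(N:_RM)$ and, for all $r\in h(R)$ and $m\in h(M)$, $rm\in N$ implies $sr\in(N:_RM)$ or $sm\in N$. $GSpec_s({}_RM)$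 is the set of all graded $s$-prime $R$-submodules of $M$. *)

(* Defs.v *)
From mathcomp Require Import all_boot all_algebra.
From mathcomp Require Import boolp classical_sets functions cardinality fsbigop.

Set Implicit Arguments.
Unset Strict Implicit.
Unset Printing Implicit Defensive.

Import GRing.Theory.
Local Open Scope classical_set_scope.
Local Open Scope ring_scope.

(* Groups are [groupType]s (possibly infinite); subgroups, additive subgroups
   and submodules are arbitrary (Prop-valued) sets. *)

Section PolycyclicByFinite.
Variable G : groupType.
Implicit Types (H K : set G) (x : G).

Definition is_subgroup H : Prop := group_closed [in H].

Definition is_normal_in H K : Prop :=
  [/\ is_subgroup H, is_subgroup K, H `<=` K &
      forall k h, K k -> H h -> H (h ^ k)%g].

Definition left_coset H x : set G := [set (x * h)%g | h in H].

(* The carrier of K / H. *)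
Definition cosets H K : set (set G) := [set left_coset H x | x in K].

(* For H normal in K, the n-th power of x H in K / H is x^n H. *)
Definition cyclic_quotient H K : Prop :=
  exists2 x, K x &
    forall C, cosets H K C ->
      exists n : nat, C = left_coset H (x ^+ n)%g \/ C = left_coset H (x ^- n)%g.

Definition polycyclic_by_finite : Prop :=
  exists (n : nat) (Gs : nat -> set G),
    [/\ Gs 0%N = [set 1%g], Gs n = [set: G] &
        forall i, (i < n)%N ->
          is_normal_in (Gs i) (Gs i.+1) /\
          (finite_set (cosets (Gs i) (Gs i.+1)) \/
           cyclic_quotient (Gs i) (Gs i.+1))].

End PolycyclicByFinite.

Section InternalDirectSum.
Variables (I : choiceType) (V : zmodType).

Definition decomposes (A : I -> set V) (x : V) (f : I -> V) : Prop :=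
  [/\ forall i, A i (f i), finite_set [set i | f i != 0] &
      x = \sum_(i \in [set: I]) f i].

Record internal_direct_sum (N : set V) (A : I -> set V) : Prop := {
  ids_subgroup : forall i, zmod_closed [in A i] ;
  ids_span : N = [set x | exists f, decomposes A x f] ;
  ids_uniq : forall x f g, decomposes A x f -> decomposes A x g -> f = g }.

End InternalDirectSum.

(* The product A B of additive subgroups: finite sums of products a b. *)
Definition product_set (U V W : zmodType) (op : U -> V -> W)
    (A : set U) (B : set V) : set W :=
  [set z | exists2 s : seq (U * V),
     (forall p, p \in s -> A p.1 /\ B p.2) & z = \sum_(p <- s) op p.1 p.2].

Section Graded.
Variables (G : groupType) (R : comNzRingType) (M : lmodType R).
Implicit Types (Rg : G -> set R) (Mg : G -> set M) (N : set M).

Definition graded_ring Rg : Prop :=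
  internal_direct_sum [set: R] Rg /\
  forall g h, product_set *%R (Rg g) (Rg h) `<=` Rg (g * h)%g.

Definition strongly_graded_ring Rg : Prop :=
  graded_ring Rg /\ forall g, product_set *%R (Rg g) (Rg g^-1%g) 1.

Definition graded_module Rg Mg : Prop :=
  internal_direct_sum [set: M] Mg /\
  forall g h, product_set *:%R (Rg g) (Mg h) `<=` Mg (g * h)%g.

(* h(R) and h(M) *)
Definition homogeneous (V : zmodType) (A : G -> set V) : set V :=
  \bigcup_(g in [set: G]) A g.

Definition nonzero_homogeneous Rg : set R := homogeneous Rg `\ 0.

(* Submodules over a subring S of R. *)
Definition is_submodule_over (S : set R) N : Prop :=
  zmod_closed [in N] /\ forall r m, S r -> N m -> N (r *: m).

(* Ascending chain condition on the S-submodules of P. *)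
Definition noetherian_over (S : set R) (P : set M) : Prop :=
  forall N : nat -> set M,
    (forall n, is_submodule_over S (N n) /\ N n `<=` P) ->
    (forall n, N n `<=` N n.+1) ->
    exists n, forall m, (n <= m)%N -> N m = N n.

Definition graded_submodule Mg N : Prop :=
  is_submodule_over [set: R] N /\
  internal_direct_sum N (fun g => N `&` Mg g).

(* (N :_R M) *)
Definition residual N : set R := [set r | forall m : M, N (r *: m)].

Definition graded_sprime Rg Mg (s : R) N : Prop :=
  [/\ graded_submodule Mg N, ~ residual N s &
      forall r m, homogeneous Rg r -> homogeneous Mg m ->
        N (r *: m) -> residual N (s * r) \/ N (s *: m)].

Definition GSpec Rg Mg (s : R) : set (set M) := [set N | graded_sprime Rg Mg s N].

End Graded.

(* Main.v *)
Require Import Defs.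
From mathcomp Require Import all_boot all_algebra.
From mathcomp Require Import boolp classical_sets functions cardinality fsbigop.

(* Among the homogeneous s outside (N : M), pick one for which the R_e-submodule
   {m in M_e : s m in N} of M_e is maximal. If r m is in N with r, m
   homogeneous and r s is outside (N : M), maximality says that r s and s
   annihilate the same elements of M_e modulo N; strong grading carries this
   from M_e to every M_g, whence s m is in N. *)

Set Implicit Arguments.
Unset Strict Implicit.
Unset Printing Implicit Defensive.

Local Open Scope classical_set_scope.
Local Open Scope ring_scope.

Import GRing.Theory.

Lemma in_zmod_closedP (V : zmodType) (A : set V) :
  zmod_closed [in A] <-> A 0 /\ forall x y, A x -> A y -> A (x - y).
Proof.
split=> [[A0 AB]|[A0 AB]].
  split=> [|x y Ax Ay]; first by move: A0; rewrite inE.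
  have := AB x y; rewrite !inE; exact.
split; first by rewrite inE.
by move=> x y; rewrite !inE; exact: AB.
Qed.

Lemma submodule_sum (R : comNzRingType) (M : lmodType R) (S : set R)
    (N : set M) (I : eqType) (s : seq I) (F : I -> M) :
  is_submodule_over S N -> (forall i, i \in s -> N (F i)) ->
  N (\sum_(i <- s) F i).
Proof.
move=> [/in_zmod_closedP[N0 NB] _] NF; rewrite big_seq.
apply: big_ind => // x y Nx Ny.
by rewrite -(opprK y); apply: (NB) => //; rewrite -(sub0r y); exact: NB.
Qed.

(** Were no member of [F] maximal, choosing a strictly larger member again and again would give an
    ascending chain that never stabilizes. *)
Lemma noetherian_maximal (R : comNzRingType) (M : lmodType R) (S : set R)
    (P : set M) (F : set (set M)) :
  noetherian_over S P ->
  (forall N, F N -> is_submodule_over S N /\ N `<=` P) ->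
  F !=set0 ->
  exists2 N, F N & forall N', F N' -> N `<=` N' -> N' = N.
Proof.
move=> noethP subF [N0 FN0]; apply: contrapT => nomax.
(* [choice] needs a total function, so outside [F] the value is [N] itself, a dummy. *)
have /choice[next nextP] : forall N, exists N',
    F N -> [/\ F N', N `<=` N' & N' <> N].
  move=> N; have [FN|nFN] := pselect (F N); last by exists N.
  apply: contrapT => maxN; apply: nomax; exists N => // N' FN' NN'.
  by apply: contrapT => N'N; apply: maxN; exists N'.
have Fiter n : F (iter n next N0) by elim: n => // n /nextP[].
have [n||n stat] := noethP (fun n => iter n next N0).
- exact: subF.
- by move=> n; case: (nextP _ (Fiter n)).
- by case: (nextP _ (Fiter n)) => _ _; apply; exact: (stat n.+1).
Qed.

Section Grading.
Variables (G : groupType) (R : comNzRingType) (M : lmodType R).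
Variables (Rg : G -> set R) (Mg : G -> set M).

Lemma graded_ringM g h a b :
  graded_ring Rg -> Rg g a -> Rg h b -> Rg (g * h)%g (a * b).
Proof.
move=> [_ RgM] Ra Rb; apply: RgM.
by exists [:: (a, b)] => [p|]; rewrite ?inE ?big_seq1 // => /eqP->.
Qed.

Lemma graded_moduleZ g h a m :
  graded_module Rg Mg -> Rg g a -> Mg h m -> Mg (g * h)%g (a *: m).
Proof.
move=> [_ MgZ] Ra Mm; apply: MgZ.
by exists [:: (a, m)] => [p|]; rewrite ?inE ?big_seq1 // => /eqP->.
Qed.

(** Strong grading in degree [1%g] puts [1] in a product of components that lies in degree
    [1 * 1^-1]. *)
Lemma strongly_graded_one : strongly_graded_ring Rg -> Rg 1%g 1.
Proof.
by move=> [[_ RgM] /(_ 1%g)]; rewrite -{3}(mulgV (1%g : G)); exact: RgM.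
Qed.

Lemma homogeneousM a b : graded_ring Rg ->
  homogeneous Rg a -> homogeneous Rg b -> homogeneous Rg (a * b).
Proof.
by move=> gR [g _ Ra] [h _ Rb]; exists (g * h)%g => //; exact: graded_ringM.
Qed.

(** The part of the colon submodule $(N :_M s)$ in degree $e$, where the chain condition is
    available. *)
Definition identity_colon (N : set M) (s : R) : set M :=
  Mg 1%g `&` [set m | N (s *: m)].

Lemma identity_colon_submodule N s : graded_module Rg Mg ->
  is_submodule_over [set: R] N ->
  is_submodule_over (Rg 1%g) (identity_colon N s).
Proof.
move=> gM [/in_zmod_closedP[N0 NB] NZ].
have /in_zmod_closedP[M0 MB] := ids_subgroup gM.1 1%g.
split=> [|r m Rr [Mm Nm]].
  apply/in_zmod_closedP; split; first by split=> //=; rewrite scaler0.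
  by move=> x y [Mx Nx] [My Ny]; split=> /=; [exact: MB|rewrite scalerBr; exact: NB].
split=> /=; first by rewrite -(mulg1 (1%g : G)); exact: graded_moduleZ.
by rewrite scalerA mulrC -scalerA; exact: NZ.
Qed.

(** For [m] of degree $g$, write $1 = \sum a_i b_i$ with $a_i \in R_g$ and $b_i \in R_{g^{-1}}$.
    Each $b_i m$ has degree $e$ and is sent into [N] by [s], hence by [t]; so $t m = \sum a_i (t b_i
    m)$ lies in [N]. *)
Lemma identity_colon_sub (N : set M) s t m : strongly_graded_ring Rg ->
  graded_module Rg Mg -> is_submodule_over [set: R] N ->
  identity_colon N s `<=` identity_colon N t ->
  homogeneous Mg m -> N (s *: m) -> N (t *: m).
Proof.
move=> [gR sR] gM subN st [g _ Mm] Nsm.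
have NZ : forall r m, N m -> N (r *: m) by move=> r m' /(subN.2 r); exact.
have [q Rq one] := sR g.
rewrite -[m]scale1r one scaler_suml scaler_sumr.
apply: submodule_sum subN _ => p /Rq[Ra Rb].
rewrite !scalerA mulrCA -!scalerA; apply: (NZ).
suff /st[] : identity_colon N s (p.2 *: m) by [].
split=> /=; first by rewrite -(mulVg g); exact: graded_moduleZ.
by rewrite scalerA mulrC -scalerA; exact: NZ.
Qed.

End Grading.

Theorem proposition4p10 (G : groupType) (R : comNzRingType) (M : lmodType R)
    (Rg : G -> set R) (Mg : G -> set M)
    (polyG : polycyclic_by_finite G)
    (gradR : strongly_graded_ring Rg)
    (gradM : graded_module Rg Mg)
    (noethMe : noetherian_over (Rg 1%g) (Mg 1%g))
    (N : set M)
    (gradN : graded_submodule Mg N)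
    (properN : N <> [set: M]) :
  exists2 s : R, nonzero_homogeneous Rg s & GSpec Rg Mg s N.
Proof.
have subN := gradN.1.
have [/in_zmod_closedP[N0 _] NZ] := subN.
pose T := [set s | homogeneous Rg s /\ ~ residual N s].
(* The family to be maximized is nonempty because [N] is proper. *)
have T1 : T 1.
  split; first by exists 1%g => //; exact: strongly_graded_one.
  move=> res1; apply: properN; apply/seteqP; split=> // m _.
  by have := res1 m; rewrite scale1r.
have [||_ [s [hs nres] <-] smax] :=
    noetherian_maximal (F := identity_colon Mg N @` T) noethMe.
- move=> _ [s _ <-]; split; first exact: identity_colon_submodule.
  by move=> m [].
- by exists (identity_colon Mg N 1); exists 1.
exists s.
  (* [s] is nonzero, since [0] sends [M] into [N]. *)
  split=> //= s0; apply: nres => m.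
  by rewrite s0 scale0r.
split=> // r m hr hm Nrm.
have [res|nresr] := pselect (residual N (s * r)); [by left|right].
(* [s * r] is again in [T], and its colon contains that of [s], so maximality forces equality. *)
have eq_colon : identity_colon Mg N (s * r) = identity_colon Mg N s.
  apply: smax; first by exists (s * r) => //; split=> //; exact: (homogeneousM gradR.1).
  by move=> x [Mx Nx]; split=> //=; rewrite mulrC -scalerA; exact: NZ.
apply: (identity_colon_sub (s := s * r) gradR gradM) => //.
  by rewrite eq_colon.
by rewrite -scalerA; exact: NZ.
Qed.
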